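(* Let $A$ be a non-empty set. Every function $h:A\to A$ admits a minimal injective power dilation.
   Context: Let $\mathbb{Z}_+=\{0,1,2,\ldots\}$; for any self-map $f$, $f^0$ is the identity. Let $A$ be a non-empty set and $h:A\to A$ a function. An injective power dilation of $h$ is a quadruple $(B,i,v,p)$ where $B$ is a set, $i:A\to B$ and $v:B\to B$ are injective functions, and $p:B\to B$ is an idempotent ($p\circ p=p$) with $p(B)=i(A)$, such that $i(h^n(a))=p(v^n(i(a)))$ for all $a\in A$, $n\in\mathbb{Z}_+$. It is called minimal if $B=\bigcup_{n=0}^{\infty}v^n(i(A))$. *)

(* Defs.v *)
From mathcomp Require Import all_boot.
From mathcomp Require Import classical_sets.

Set Implicit Arguments.
Unset Strict Implicit.
Unset Printing Implicit Defensive.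

Local Open Scope classical_set_scope.

Record injective_power_dilation (A : Type) (h : A -> A)
    (B : Type) (i : A -> B) (v p : B -> B) : Prop := InjectivePowerDilation {
  ipd_i_inj : injective i;
  ipd_v_inj : injective v;
  ipd_p_idem : p \o p = p;
  ipd_p_range : range p = range i;
  ipd_power : forall (a : A) (n : nat), i (iter n h a) = p (iter n v (i a))
}.

Definition minimal_dilation (A B : Type) (i : A -> B) (v : B -> B) : Prop :=
  [set: B] = \bigcup_(n : nat) (iter n v @` range i).

(* Main.v *)
Require Import Defs.
From mathcomp Require Import all_boot.
From mathcomp Require Import classical_sets.

(** The dilation space keeps a record of the dynamics instead of carrying it
    out: a point [(a, n)] of [A * nat] stands for the formal expression
    [h^n a].  Delaying one more application of [h] only increments the
    counter, so it is injective even when [h] is not, and all the loss of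
    information is moved into the idempotent, which evaluates the expression
    and resets the counter.  Minimality holds since [(a, n)] is reached from
    [(a, 0)] by [n] delays. *)

Definition now {A : Type} (a : A) : A * nat := (a, 0).

Definition delay {A : Type} (x : A * nat) : A * nat := (x.1, x.2.+1).

Definition evaluate {A : Type} (h : A -> A) (x : A * nat) : A * nat :=
  now (iter x.2 h x.1).

Lemma iter_delay (A : Type) (n : nat) (a : A) : iter n delay (now a) = (a, n).
Proof. by elim: n => [|n IHn] //=; rewrite IHn. Qed.

Lemma now_inj (A : Type) : injective (@now A).
Proof. by move=> a b []. Qed.

Lemma delay_inj (A : Type) : injective (@delay A).
Proof. by move=> [a m] [b n] [-> ->]. Qed.

Lemma range_evaluate (A : Type) (h : A -> A) :
  range (evaluate h) = range (@now A).
Proof.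
apply/seteqP; split=> _ [x _ <-]; first by exists (iter x.2 h x.1).
by exists (now x).
Qed.

Theorem theorem1p7 (A : Type) (A_nonempty : inhabited A) (h : A -> A) :
  exists (B : Type) (i : A -> B) (v p : B -> B),
    injective_power_dilation h i v p /\ minimal_dilation i v.
Proof.
exists (A * nat)%type, now, delay, (evaluate h); split.
- split; [exact: now_inj | exact: delay_inj | | exact: range_evaluate |].
  (* An evaluated expression has counter 0, so evaluating it again iterates
     [h] zero times: both sides are convertible. *)
  + by [].
  + by move=> a n; rewrite iter_delay.
- apply/seteqP; split=> // -[a n] _; exists n => //.
  by exists (now a); [exists a | exact: iter_delay].
Qed.
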